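(* Let $C$ be an $(N+1)d\times(N+1)d$ positive definite block matrix (with $N+1$ blocks in each row/column, each block being $d\times d$). Then $C^{-1}$ is cyclic block tri-diagonal if and only if $$C=B^L+\Gamma^LD^L(\Gamma^L)'=B^F+\Gamma^FD^F(\Gamma^F)'$$ for some $d\times d$ positive definite matrices $D^L$ and $D^F$ and some $$B^L=\begin{bmatrix} B_1 & 0 \\ 0 & 0 \end{bmatrix},\quad\Gamma^L=\begin{bmatrix} S_1 \\ I \end{bmatrix},\quad B^F=\begin{bmatrix} 0 & 0 \\ 0 & B_2 \end{bmatrix},\quad\Gamma^F=\begin{bmatrix} I \\ S_2 \end{bmatrix},$$ where $(B_1)^{-1}$ and $(B_2)^{-1}$ are $Nd\times Nd$ block tri-diagonal, $S_1$ and $S_2$ are $Nd\times d$, and $I$ is the $d\times d$ identity matrix.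
   Context: $N$ is a positive integer; the prime denotes matrix transposition. Block tri-diagonality refers to $d\times d$ blocks. A symmetric block matrix $A=(A_{i,j})_{0\le i,j\le N}$ with $d\times d$ blocks is cyclic block tri-diagonal if $A_{i,j}=0$ whenever $|i-j|\ge2$ and $\{i,j\}\ne\{0,N\}$ (i.e. block tri-diagonal except that the two corner blocks $A_{0,N}$, $A_{N,0}$ are arbitrary). *)

(* Defs.v *)
From mathcomp Require Import all_boot all_order all_algebra.
From mathcomp Require Import reals.

Set Implicit Arguments.
Unset Strict Implicit.
Unset Printing Implicit Defensive.

Import Order.TTheory GRing.Theory Num.Theory.
Local Open Scope ring_scope.

Definition posdefmx (R : realFieldType) (n : nat) (A : 'M[R]_n) : Prop :=
  A^T = A /\ forall x : 'cV[R]_n, x != 0 -> 0 < (x^T *m A *m x) 0 0.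

(* n * d, written as a sum so that MathComp's submxblock applies: a matrix of
   type 'M_(n `x d) has n block rows and columns, with d x d blocks. *)
Notation "n `x d" := (\sum_(i < n) d)%N
  (at level 35, d at level 35, no associativity) : nat_scope.

Definition blk (R : Type) (n d : nat) (A : 'M[R]_(n `x d)) (i j : 'I_n) :
    'M[R]_d :=
  @submxblock R n n (fun=> d) (fun=> d) A i j.

Definition block_tridiagonal (R : realFieldType) (n d : nat)
    (A : 'M[R]_(n `x d)) : Prop :=
  forall i j : 'I_n, (2 <= `|i - j|)%N -> blk A i j = 0.

Definition cyclic_block_tridiagonal (R : realFieldType) (N d : nat)
    (A : 'M[R]_(N.+1 `x d)) : Prop :=
  A^T = A /\
  forall i j : 'I_N.+1, (2 <= `|i - j|)%N ->
    [set i; j] != [set ord0; ord_max] -> blk A i j = 0.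

Lemma bsize_last (N d : nat) : (N `x d + d = N.+1 `x d)%N.
Proof. by rewrite big_ord_recr. Qed.

Lemma bsize_first (N d : nat) : (d + N `x d = N.+1 `x d)%N.
Proof. by rewrite big_ord_recl. Qed.

Definition BL (R : realFieldType) (N d : nat) (B1 : 'M[R]_(N `x d)) :
    'M[R]_(N.+1 `x d) :=
  castmx (bsize_last N d, bsize_last N d)
    (block_mx B1 0 0 (0 : 'M[R]_d)).

Definition GammaL (R : realFieldType) (N d : nat) (S1 : 'M[R]_(N `x d, d)) :
    'M[R]_(N.+1 `x d, d) :=
  castmx (bsize_last N d, erefl d) (col_mx S1 1%:M).

Definition BF (R : realFieldType) (N d : nat) (B2 : 'M[R]_(N `x d)) :
    'M[R]_(N.+1 `x d) :=
  castmx (bsize_first N d, bsize_first N d)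
    (block_mx (0 : 'M[R]_d) 0 0 B2).

Definition GammaF (R : realFieldType) (N d : nat) (S2 : 'M[R]_(N `x d, d)) :
    'M[R]_(N.+1 `x d, d) :=
  castmx (bsize_first N d, erefl d) (col_mx 1%:M S2).

(* Main.v *)
(** In both representations [B] is forced to be a Schur complement of [C], so its
    inverse is the leading (resp. trailing) principal [N x N]-block submatrix of
    [C^-1]. A pair [{i, j}] other than [{0, N}] avoids [0] or avoids [N], hence
    [C^-1] is cyclic block tri-diagonal iff these two submatrices are block
    tri-diagonal. *)
Require Import Defs.
From mathcomp Require Import all_boot all_order all_algebra.
From mathcomp Require Import reals zify.

Import Order.TTheory GRing.Theory Num.Theory.
Local Open Scope ring_scope.

Lemma posdefmx_unit {R : realFieldType} {n : nat} {A : 'M[R]_n} :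
  posdefmx A -> A \in unitmx.
Proof.
case=> _ posA; rewrite -row_free_unit -kermx_eq0.
apply/rowV0P => v /sub_kermxP vA0; apply/eqP/contraT => v0.
have := posA v^T; rewrite -trmx0 (inj_eq trmx_inj) => /(_ v0).
by rewrite trmxK vA0 mul0mx mxE ltxx.
Qed.

(** The left inverse [V^T] makes [V] injective, so the quadratic form is only evaluated at nonzero
    vectors [V *m x]. *)
Lemma posdefmx_congr {R : realFieldType} {n m : nat} {A : 'M[R]_n}
    {V : 'M[R]_(n, m)} :
  posdefmx A -> V^T *m V = 1%:M -> posdefmx (V^T *m A *m V).
Proof.
case=> symA posA VV; split; first by rewrite !trmx_mul trmxK symA mulmxA.
move=> x x0; have Vx0 : V *m x != 0.
  apply: contra_neq x0 => Vx0.
  by rewrite -[x]mul1mx -VV -mulmxA Vx0 mulmx0.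
by have := posA _ Vx0; rewrite trmx_mul !mulmxA.
Qed.

Definition sel_up {R : pzSemiRingType} {m k n : nat} (e : (m + k = n)%N) :
    'M[R]_(n, m) :=
  castmx (e, erefl m) (col_mx 1%:M 0).

Definition sel_down {R : pzSemiRingType} {m k n : nat} (e : (m + k = n)%N) :
    'M[R]_(n, k) :=
  castmx (e, erefl k) (col_mx 0 1%:M).

(** An orthogonal splitting of the coordinates, symmetric in [U] and [V]: one Schur argument then
    serves both representations, with the kept blocks on top for L and at the bottom for F. *)
Definition complementary {R : pzSemiRingType} {m k n : nat}
    (U : 'M[R]_(n, m)) (V : 'M[R]_(n, k)) : Prop :=
  [/\ U^T *m U = 1%:M, V^T *m V = 1%:M, U^T *m V = 0, V^T *m U = 0
    & U *m U^T + V *m V^T = 1%:M].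

Lemma complementary_sym {R : pzSemiRingType} {m k n : nat}
    {U : 'M[R]_(n, m)} {V : 'M[R]_(n, k)} :
  complementary U V -> complementary V U.
Proof. by case=> UU VV UV VU UUVV; split; rewrite // addrC. Qed.

Lemma sel_complementary {R : comPzRingType} {m k n : nat} (e : (m + k = n)%N) :
  complementary (sel_up e : 'M[R]_(n, m)) (sel_down e).
Proof.
case: _ / e; rewrite /complementary /sel_up /sel_down !castmx_id.
rewrite !tr_col_mx !mul_row_col !mul_col_row !trmx1 !trmx0.
rewrite !(mul0mx, mulmx0, mul1mx, addr0, add0r) add_block_mx.
by rewrite !(addr0, add0r) -scalar_mx_block.
Qed.

Lemma sel_up_conj {R : comPzRingType} {m k n : nat} (e : (m + k = n)%N)
    (K : 'M[R]_n) :
  (sel_up e)^T *m K *m sel_up e =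
  mxsub (cast_ord e \o lshift k) (cast_ord e \o lshift k) K.
Proof.
case: _ / e K => K; rewrite /sel_up castmx_id tr_col_mx trmx1 trmx0.
rewrite -{1}[K]submxK mul_row_block mul_row_col.
rewrite !(mul1mx, mulmx1, mul0mx, mulmx0, addr0, add0r).
by apply/matrixP=> i j; rewrite !mxE /= !cast_ord_id.
Qed.

Lemma sel_down_conj {R : comPzRingType} {m k n : nat} (e : (m + k = n)%N)
    (K : 'M[R]_n) :
  (sel_down e)^T *m K *m sel_down e =
  mxsub (cast_ord e \o @rshift m k) (cast_ord e \o @rshift m k) K.
Proof.
case: _ / e K => K; rewrite /sel_down castmx_id tr_col_mx trmx1 trmx0.
rewrite -{1}[K]submxK mul_row_block mul_row_col.
rewrite !(mul1mx, mulmx1, mul0mx, mulmx0, addr0, add0r).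
by apply/matrixP=> i j; rewrite !mxE /= !cast_ord_id.
Qed.

(* Multiply [C] on the left by [U^T - S *m V^T], which kills [U *m S + V]. *)
Lemma schur_inv {R : comUnitRingType} {m k n : nat} {U : 'M[R]_(n, m)}
    {V : 'M[R]_(n, k)} {C : 'M[R]_n} {B : 'M[R]_m} {S : 'M[R]_(m, k)}
    {D : 'M[R]_k} :
  complementary U V -> C \in unitmx ->
  C = U *m B *m U^T + (U *m S + V) *m D *m (U *m S + V)^T ->
  B \in unitmx /\ invmx B = U^T *m invmx C *m U.
Proof.
case=> UU VV UV VU _ unitC defC.
have killC : (U^T - S *m V^T) *m C = B *m U^T.
  rewrite defC mulmxDr !mulmxA !mulmxDr !mulmxBl !mulmxA UU UV.
  by rewrite -!(mulmxA S) VU VV !(mulmx0, mul0mx) !mul1mx mulmx1 !subr0 sub0r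
    subrr !mul0mx addr0.
have BK : B *m (U^T *m invmx C *m U) = 1%:M.
  by rewrite !mulmxA -killC mulmxK // mulmxBl UU -mulmxA VU mulmx0 subr0.
have [unitB _] := mulmx1_unit BK.
split=> //.
by rewrite -[RHS]mul1mx -(mulVmx unitB) -(mulmxA (invmx B)) BK mulmx1.
Qed.

(** Block elimination with pivot [D], the compression of [C] to the range of [V]; positive
    definiteness makes this pivot invertible. The matrix [B] is the Schur complement of [D]. *)
Lemma schur_ex {R : realFieldType} {m k n : nat} {U : 'M[R]_(n, m)}
    {V : 'M[R]_(n, k)} {C : 'M[R]_n} :
  complementary U V -> posdefmx C ->
  exists (D : 'M[R]_k) (B : 'M[R]_m) (S : 'M[R]_(m, k)),
    posdefmx D /\ C = U *m B *m U^T + (U *m S + V) *m D *m (U *m S + V)^T.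
Proof.
case=> _ VV _ _ UUVV posC.
(* The existential keeps [D] opaque, so it unfolds only through [defD]. *)
have [D defD] : exists D, D = V^T *m C *m V by exists (V^T *m C *m V).
have posD : posdefmx D by rewrite defD; apply: posdefmx_congr.
have unitD := posdefmx_unit posD; case: (posD) => symD _; case: posC => symC _.
have [S SD] : exists S, S *m D = U^T *m C *m V.
  by exists (U^T *m C *m V *m invmx D); rewrite mulmxKV.
have DS : D *m S^T = V^T *m C *m U.
  by rewrite -{1}symD -trmx_mul SD !trmx_mul trmxK symC mulmxA.
exists D, (U^T *m C *m U - S *m D *m S^T), S; split=> //.
have -> : (U *m S + V)^T = S^T *m U^T + V^T by rewrite linearD /= trmx_mul.
(* Inserting [U *m U^T + V *m V^T] on both sides of [C] splits it into four blocks. The mixed and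
   [V] blocks match directly; in the [U] block, the [S *m D *m S^T] subtracted in [B] cancels the
   one produced by the last product. *)
rewrite -[LHS]mul1mx -[LHS]mulmx1 -UUVV.
rewrite !(mulmxDl, mulmxDr, mulmxBl, mulmxN, mulNmx) !mulmxA.
rewrite -(mulmxA V D) DS -(mulmxA U S D) SD defD !mulmxA.
by rewrite -!addrA; congr (_ + _); rewrite addrCA [RHS]addrCA addKr.
Qed.

(** This and the next three lemmas bring the representations into the common shape of [schur_ex] and
    [schur_inv]. *)
Lemma BL_sel {R : realFieldType} {N d : nat} (B : 'M[R]_(N `x d)) :
  BL B = sel_up (bsize_last N d) *m B *m (sel_up (bsize_last N d))^T.
Proof.
rewrite /BL /sel_up; case: _ / (bsize_last N d); rewrite !castmx_id.
by rewrite tr_col_mx trmx1 trmx0 mul_col_mx mul_col_row mul1mx !mul0mx mulmx1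
  mulmx0.
Qed.

Lemma GammaL_sel {R : realFieldType} {N d : nat} (S : 'M[R]_(N `x d, d)) :
  GammaL S = sel_up (bsize_last N d) *m S + sel_down (bsize_last N d).
Proof.
rewrite /GammaL /sel_up /sel_down; case: _ / (bsize_last N d).
by rewrite !castmx_id mul_col_mx add_col_mx mul1mx mul0mx addr0 add0r.
Qed.

Lemma BF_sel {R : realFieldType} {N d : nat} (B : 'M[R]_(N `x d)) :
  BF B = sel_down (bsize_first N d) *m B *m (sel_down (bsize_first N d))^T.
Proof.
rewrite /BF /sel_down; case: _ / (bsize_first N d); rewrite !castmx_id.
by rewrite tr_col_mx trmx1 trmx0 mul_col_mx mul_col_row mul1mx !mul0mx mulmx1
  mulmx0.
Qed.

Lemma GammaF_sel {R : realFieldType} {N d : nat} (S : 'M[R]_(N `x d, d)) :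
  GammaF S = sel_down (bsize_first N d) *m S + sel_up (bsize_first N d).
Proof.
rewrite /GammaF /sel_up /sel_down; case: _ / (bsize_first N d).
by rewrite !castmx_id mul_col_mx add_col_mx mul1mx mul0mx addr0 add0r.
Qed.

(** The offset of block [i] sums the sizes of the earlier blocks, all equal to [d]. This explicit
    value lets flat indices be compared between [N] and [N.+1] blocks. *)
Lemma val_Rank_const {n d : nat} (i : 'I_n) (x : 'I_d) :
  @tagnat.Rank n (fun=> d) i x = (i * d + x)%N :> nat.
Proof.
rewrite [LHS]tagnat.RankEsum (big_ord_narrow (ltnW (ltn_ord i))).
by rewrite sum_nat_const card_ord.
Qed.

Lemma blk_sel_up {R : realFieldType} {N d : nat} (K : 'M[R]_(N.+1 `x d))
    (i j : 'I_N) :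
  blk ((sel_up (bsize_last N d))^T *m K *m sel_up (bsize_last N d)) i j =
  blk K (widen_ord (leqnSn N) i) (widen_ord (leqnSn N) j).
Proof.
rewrite sel_up_conj; apply/matrixP=> x y; rewrite !mxE.
congr (K _ _); apply: val_inj;
  by rewrite [LHS]val_Rank_const [RHS]val_Rank_const.
Qed.

Lemma blk_sel_down {R : realFieldType} {N d : nat} (K : 'M[R]_(N.+1 `x d))
    (i j : 'I_N) :
  blk ((sel_down (bsize_first N d))^T *m K *m sel_down (bsize_first N d)) i j =
  blk K (lift ord0 i) (lift ord0 j).
Proof.
rewrite sel_down_conj; apply/matrixP=> x y; rewrite !mxE.
(* Skipping the first block adds [d] to the flat index, which is the same as raising the block index
   by one. *)
have shift (a : 'I_N) (z : 'I_d) :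
    (d + @tagnat.Rank N (fun=> d) a z)%N =
    @tagnat.Rank N.+1 (fun=> d) (lift ord0 a) z :> nat.
  by rewrite !val_Rank_const /= mulSn addnA.
by congr (K _ _); apply: val_inj; apply: shift.
Qed.

Lemma cyclic_block_tridiagonal_sel {R : realFieldType} {N d : nat}
    {K : 'M[R]_(N.+1 `x d)} :
  K^T = K ->
  cyclic_block_tridiagonal K <->
  block_tridiagonal
    ((sel_up (bsize_last N d))^T *m K *m sel_up (bsize_last N d)) /\
  block_tridiagonal
    ((sel_down (bsize_first N d))^T *m K *m sel_down (bsize_first N d)).
Proof.
move=> symK; split=> [[_ cycK]|[triU triD]].
  split=> i j ij.
    (* Both indices lie below [N], so [ord_max] distinguishes their pair from the corner pair; in
       the trailing case below, [ord0] does. *)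
    rewrite blk_sel_up; apply: cycK => //; apply/eqP => /setP /(_ ord_max).
    by rewrite !inE eqxx orbT -!val_eqE /= !gtn_eqF.
  rewrite blk_sel_down; apply: cycK.
    by move: ij; rewrite !lift0 !intS opprD addrACA subrr add0r.
  by apply/eqP => /setP /(_ ord0); rewrite !inE eqxx.
split=> // i j ij ij0N.
have [iN|] := boolP ((i < N)%N && (j < N)%N).
  case/andP: iN => iN jN; have := triU (Ordinal iN) (Ordinal jN) ij.
  by rewrite blk_sel_up; congr (blk K _ _ = 0); apply: val_inj.
rewrite negb_and -!leqNgt => ijN.
(* One index is now [N]. Were the other [0], the pair would be the excluded corner; hence both are
   successors and the trailing submatrix applies. *)
case: (unliftP ord0 i) ij ij0N ijN => [i'|] -> ij ij0N ijN; last first.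
  have jN : j = ord_max.
    by apply/val_inj; move: (ltn_ord j) ijN; rewrite /=; clear; lia.
  by rewrite jN eqxx in ij0N.
case: (unliftP ord0 j) ij ij0N ijN => [j'|] -> ij ij0N ijN; last first.
  have iN : lift ord0 i' = ord_max.
    by apply/val_inj; move: (ltn_ord i') ijN; rewrite lift0 /= /bump; clear; lia.
  by rewrite iN setUC eqxx in ij0N.
rewrite -blk_sel_down; apply: triD.
by move: ij; rewrite !lift0 !intS opprD addrACA subrr add0r.
Qed.

Theorem corollary4p5 (R : realType) (N d : nat) (hN : (0 < N)%N)
    (C : 'M[R]_(N.+1 `x d)) (hC : posdefmx C) :
  cyclic_block_tridiagonal (invmx C) <->
  exists (DL DF : 'M[R]_d) (B1 B2 : 'M[R]_(N `x d)) (S1 S2 : 'M[R]_(N `x d, d)),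
    [/\ posdefmx DL /\ posdefmx DF,
        B1 \in unitmx /\ block_tridiagonal (invmx B1),
        B2 \in unitmx /\ block_tridiagonal (invmx B2),
        C = BL B1 + GammaL S1 *m DL *m (GammaL S1)^T
      & C = BF B2 + GammaF S2 *m DF *m (GammaF S2)^T].
Proof.
have unitC := posdefmx_unit hC.
have symK : (invmx C)^T = invmx C by rewrite trmx_inv; case: hC => ->.
have selL := @sel_complementary R _ _ _ (bsize_last N d).
have selF := complementary_sym (@sel_complementary R _ _ _ (bsize_first N d)).
rewrite (cyclic_block_tridiagonal_sel symK); split.
  (* Positive definiteness of [C] alone yields both decompositions; cyclic tri-diagonality is then
     carried to [invmx B1] and [invmx B2] by [inv1] and [inv2]. *)
  have [DL [B1 [S1 [posL defL]]]] := schur_ex selL hC.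
  have [DF [B2 [S2 [posF defF]]]] := schur_ex selF hC.
  have [unit1 inv1] := schur_inv selL unitC defL.
  have [unit2 inv2] := schur_inv selF unitC defF.
  rewrite -inv1 -inv2 => -[tri1 tri2]; exists DL, DF, B1, B2, S1, S2.
  by rewrite BL_sel GammaL_sel BF_sel GammaF_sel; split.
case=> DL [DF [B1 [B2 [S1 [S2 [_ [_ tri1] [_ tri2]]]]]]].
rewrite BL_sel GammaL_sel BF_sel GammaF_sel => defL defF.
(* The given [B1] and [B2] need not be those built by [schur_ex], but [schur_inv] identifies the
   inverse in any such representation. *)
have [_ <-] := schur_inv selL unitC defL.
by have [_ <-] := schur_inv selF unitC defF.
Qed.
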